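(* Assume that $n$ is even, let $\tau=\{m-n+1,\dots,m-1,m\}$, and assume that $c=\lambda_{m-n}/\lambda_{m-n+1}>2$. Let $y\in\mathbb{R}^m$ be such that $y_i\neq 0$ for $i\in\tau$ and $y_i=0$ for $i\notin\tau$. Then the degrees-of-freedom estimate at $y$ satisfies $$\widehat{\mathrm{GDoF}}(y)<n .$$
   Context: Let $1\le n<m$ be integers and let $\lambda_1>\lambda_2>\cdots>\lambda_m>0$ be real numbers; $\Lambda=\operatorname{diag}(\lambda)$. $V$ is the $m\times n$ Vandermonde matrix with $V_{i,k}=\lambda_i^{k-1}$. For $y\in\mathbb{R}^m$ with at least $n$ non-zero entries let $Y=\operatorname{diag}(y)$; then $V^TY^2\Lambda V$ is non-singular and the PLS prediction with $n$ directions is $\hat y(y)=Py$, where $P=Y\Lambda V(V^TY^2\Lambda V)^{-1}V^TY$. The sample generalised degrees of freedom is $\widehat{\mathrm{GDoF}}(y)=\operatorname{tr}(J)$, where $J=\partial\hat y/\partial y^T$ is the Jacobian matrix at $y$ of the map $y\mapsto\hat y(y)$ (defined on the open set of $y$ with at least $n$ non-zero entries). *)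

(* Defs.v *)
From mathcomp Require Import all_boot all_order all_algebra.
From mathcomp Require Import all_classical all_reals all_analysis.

Set Implicit Arguments.
Unset Strict Implicit.
Unset Printing Implicit Defensive.

Import Order.TTheory GRing.Theory Num.Theory.
Import numFieldNormedType.Exports.

Local Open Scope ring_scope.

(* Indices are 0-based: lam 0 i and y 0 i stand for lambda_(i+1) and y_(i+1).
   The vectors lambda, y and hat y are stored as row vectors, because the
   library's Jacobian is defined for maps between row vectors; transposes are
   inserted wherever a column vector is meant. *)

(* [Vandermonde n lam] has the powers lambda_j ^+ i as rows, so its transpose
   has entries V i k = lam 0 i ^+ k. *)
Definition pls_V (R : realType) (m n : nat) (lam : 'rV[R]_m) : 'M[R]_(m, n) :=
  (Vandermonde n lam)^T.

(* [invmx] is the inverse only when V^T Y^2 Lambda V is non-singular, which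
   holds when y has at least n non-zero entries. *)
Definition pls_P (R : realType) (m n : nat) (lam y : 'rV[R]_m) : 'M[R]_m :=
  let V := pls_V n lam in
  let Y := diag_mx y in
  let L := diag_mx lam in
  Y *m L *m V *m invmx (V^T *m (Y *m Y) *m L *m V) *m V^T *m Y.

Definition pls_pred (R : realType) (m n : nat) (lam y : 'rV[R]_m) : 'rV[R]_m :=
  (pls_P n lam y *m y^T)^T.

(* [jacobian f y] acts on row vectors by right multiplication: its (i, j) entry
   is the derivative of the j-th component of f in the i-th variable.  Hence
   the transpose. *)
Definition pls_J (R : realType) (m n : nat) (lam y : 'rV[R]_m) : 'M[R]_m :=
  (jacobian (pls_pred n lam) y)^T.

Definition sample_GDoF (R : realType) (m n : nat) (lam y : 'rV[R]_m) : R :=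
  \tr (pls_J n lam y).

(* The positions m-n+1, ..., m, i.e. m-n, ..., m-1 when counting from 0. *)
Definition last_indices (m n : nat) : {set 'I_m} :=
  [set i : 'I_m | (m - n <= i)%N].

(* Main.v *)
(* Write tau for the support of y and let r be the polynomial of degree n with
   r(0) = 0 and r = 1 on {lambda_j : j in tau}, so that
   1 - r(x) = prod_(j in tau) (1 - x / lambda_j).
   The normal equations express the prediction at z near y as
   z_i r(lambda_i) plus a bounded matrix applied to the vector of the
   z_j^2 (1 - r(lambda_j)).  That vector vanishes on tau, and off tau
   z_j = (z - y)_j, so it is quadratic in z - y.  Hence the prediction is
   differentiable at y with Jacobian diag(r(lambda_i)).  The trace
   contributes 1 for each of the n indices in tau, and for i not in tau the
   entry 1 - prod_(j in tau) (1 - lambda_i / lambda_j) is negative: there are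
   evenly many factors, all of absolute value > 1 because
   lambda_i / lambda_j >= c > 2. *)

Require Import Defs.
From mathcomp Require Import all_boot all_order all_algebra.
From mathcomp Require Import all_classical all_reals all_analysis.
From mathcomp Require Import ring.

Set Implicit Arguments.
Unset Strict Implicit.
Unset Printing Implicit Defensive.

Import Order.TTheory GRing.Theory Num.Theory.
Import numFieldNormedType.Exports.

Local Open Scope classical_set_scope.
Local Open Scope ring_scope.

(** * Norm bounds and recognition of the Jacobian *)

Section MatrixNorm.
Variable R : realType.

Lemma le_mx_entry_norm m n (A : 'M[R]_(m, n)) i j : `|A i j| <= `|A|.
Proof.
by rewrite [leRHS]/Num.norm/= mx_normrE; apply/bigmax_geP; right; exists (i, j).
Qed.

Lemma mx_norm_le m n (A : 'M[R]_(m, n)) e :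
  0 <= e -> (forall i j, `|A i j| <= e) -> `|A| <= e.
Proof.
move=> e0 Ae; rewrite [leLHS]/Num.norm/= mx_normrE.
by apply/bigmax_leP; split=> // -[i j] _; exact: Ae.
Qed.

Lemma mulmxr_continuous m n (A : 'M[R]_(m, n)) :
  continuous (mulmxr A : 'rV[R]_m -> 'rV[R]_n).
Proof.
apply/linear_bounded_continuous/linear_boundedP.
exists (\sum_i \sum_j `|A i j|); split; first by rewrite num_real.
move=> r /ltW Ar x; apply: mx_norm_le => [|i j].
  apply: mulr_ge0 => //; apply: le_trans Ar.
  by apply: sumr_ge0 => ? _; exact: sumr_ge0.
rewrite mxE (le_trans (ler_norm_sum _ _ _))//.
apply: le_trans (ler_wpM2r _ Ar) => //.
rewrite mulr_suml; apply: ler_sum => k _.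
rewrite normrM mulrC ler_pM ?le_mx_entry_norm//.
by rewrite (bigD1 j)//= lerDl sumr_ge0.
Qed.

(** A quadratic error is o(h) and the differential is unique, so the Jacobian is identified without
    computing any derivative. *)
Lemma jacobian_quadratic_remainder m n (f : 'rV[R]_m -> 'rV[R]_n) x
    (A : 'M[R]_(m, n)) (K : R) :
  (\forall h \near (0 : 'rV[R]_m),
     `|f (h + x) - f x - h *m A| <= K * `|h| ^+ 2) ->
  jacobian f x = A.
Proof.
move=> fA.
suff -> : jacobian f x = lin1_mx (mulmxr A).
  by apply/row_matrixP => i; rewrite rowE mul_rV_lin1/= -rowE.
congr lin1_mx; apply: diff_unique; first exact: mulmxr_continuous.
apply/eqaddoP => e e0.
(* [K] may have any sign, while [|K| + 1] is a positive bound that can be divided by. *)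
have K1 : 0 < `|K| + 1 by rewrite ltr_wpDl.
have : \forall h \near (0 : 'rV[R]_m), `|h| < e / (`|K| + 1).
  by apply: nbhs0_lt; rewrite divr_gt0.
apply: filterS2 fA => h fA he /=.
rewrite opprD addrA; apply: le_trans fA _.
rewrite expr2 mulrA ler_wpM2r//.
apply: (@le_trans _ _ ((`|K| + 1) * `|h|)).
  by rewrite ler_wpM2r// (le_trans (ler_norm K))// lerDl.
by rewrite mulrC -ler_pdivlMr// ltW.
Qed.

End MatrixNorm.

(** * Entrywise limits of matrix products, determinants and inverses *)

Section EntrywiseLimits.
Variables (R : realType) (T : Type) (F : set_system T).
Context {FF : Filter F}.

Lemma cvg_mulmx_entries m n p (A : T -> 'M[R]_(m, n)) (B : T -> 'M[R]_(n, p))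
    (A0 : 'M[R]_(m, n)) (B0 : 'M[R]_(n, p)) :
  (forall i j, A t i j @[t --> F] --> A0 i j) ->
  (forall i j, B t i j @[t --> F] --> B0 i j) ->
  forall i j, (A t *m B t) i j @[t --> F] --> (A0 *m B0) i j.
Proof.
move=> cA cB i j; rewrite mxE; under eq_fun do rewrite mxE.
apply: cvg_big => [|k _]; first exact: add_continuous.
by apply: cvgM; [exact: cA|exact: cB].
Qed.

Lemma cvg_det n (A : T -> 'M[R]_n) (A0 : 'M[R]_n) :
  (forall i j, A t i j @[t --> F] --> A0 i j) ->
  \det (A t) @[t --> F] --> \det A0.
Proof.
move=> cA; apply: cvg_big => [|s _]; first exact: add_continuous.
apply: cvgM; first exact: cvg_cst.
by apply: cvg_big => [|i _]; [exact: mul_continuous|exact: cA].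
Qed.

(** The determinant stays non-zero near the limit, and there the inverse is the adjugate divided by
    the determinant, both polynomial in the entries. *)
Lemma cvg_invmx_entries n (A : T -> 'M[R]_n) (A0 : 'M[R]_n) :
  A0 \in unitmx -> (forall i j, A t i j @[t --> F] --> A0 i j) ->
  (\forall t \near F, A t \in unitmx) /\
  (forall i j, invmx (A t) i j @[t --> F] --> invmx A0 i j).
Proof.
move=> A0u cA; have cdet := cvg_det cA.
have d0 : \det A0 != 0 by move: A0u; rewrite unitmxE unitfE.
have Au : \forall t \near F, A t \in unitmx.
  apply: filterS (cvgr_neq0 _ cdet d0) => t.
  by rewrite unitmxE unitfE.
split=> // i j; rewrite /invmx A0u mxE.
have AE : {near F, (fun t => (\det (A t))^-1 * \adj (A t) i j) =1
    (fun t => (if A t \in unitmx then (\det (A t))^-1 *: \adj (A t)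
               else A t) i j)}.
  by apply: filterS Au => t /= ->; rewrite [RHS]mxE.
apply: cvg_trans (near_eq_cvg AE) _.
apply: cvgM; first exact: cvgV.
rewrite mxE; under eq_fun do rewrite mxE.
apply: cvgM; first exact: cvg_cst.
apply: cvg_det => k l; rewrite !mxE; under eq_fun do rewrite !mxE.
exact: cA.
Qed.

End EntrywiseLimits.

(** The product is 1 at x = 0, so 1 minus it is divisible by x; the quotient has at most |S|
    coefficients. With a_j = 1 / lambda_j this is r(x). *)
Lemma horner_prod_interpolation (F : comNzRingType) (I : finType) (S : {set I})
    (a : I -> F) n :
  (#|S| <= n)%N ->
  exists u : 'rV[F]_n, forall x,
    x * (rVpoly u).[x] = 1 - \prod_(j in S) (1 - a j * x).
Proof.
move=> Sn.
have [q [sq qE]] : exists q : {poly F}, (size q <= size (enum S))%N /\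
    forall x, x * q.[x] = 1 - \prod_(j <- enum S) (1 - a j * x).
  elim: (enum S) => [|j s [q [sq qE]]].
    exists 0; rewrite size_poly0; split=> // x.
    by rewrite big_nil horner0 mulr0 subrr.
  (* If P = 1 - x q(x), then 1 - (1 - a_j x) P = x (q(x) + a_j (1 - x q(x))). *)
  exists ((- (a j *: q)) * 'X + (a j)%:P + q); split=> [|x].
    rewrite (leq_trans (size_polyD _ _))// geq_max size_MXaddC.
    case: ifP => _ /=; rewrite (leq_trans sq)// ?andbT ?ltnS ?size_polyN.
    exact: leq_trans (size_scale_leq _ _) sq.
  rewrite big_cons !hornerE; have := qE x.
  move: (\prod_(_ <- _) _) => P qP.
  have -> : P = 1 - x * q.[x] by rewrite qP opprB addrC subrK.
  by ring.
exists (poly_rV q) => x; rewrite poly_rV_K.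
  by rewrite qE big_enum.
by rewrite (leq_trans sq)// -cardE.
Qed.

(** * The Gram matrix and the Jacobian of the PLS prediction *)

Section PLS.
Variables (R : realType) (m n : nat) (lam : 'rV[R]_m).
Implicit Types (y z : 'rV[R]_m) (u : 'rV[R]_n).

Local Notation V := (pls_V n lam).

Definition pls_gram y : 'M[R]_n :=
  V^T *m (diag_mx y *m diag_mx y) *m diag_mx lam *m V.

(** This is [pls_P] without its last factor Y, which is left to act on the residual and supplies one
    of the two powers of z_j there. *)
Definition pls_gain y : 'M[R]_m :=
  diag_mx y *m diag_mx lam *m V *m invmx (pls_gram y) *m V^T.

Lemma mul_pls_V_tr u i : (V *m u^T) i 0 = (rVpoly u).[lam 0 i].
Proof.
rewrite mxE horner_poly; apply: eq_bigr => k _.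
by rewrite !mxE valK mulrC.
Qed.

(** For p the polynomial with coefficients u, the quadratic form at u is the sum of lambda_i (y_i
    p(lambda_i))^2. If it vanishes, p has at least n distinct roots but size at most n, so p = 0. *)
Lemma pls_gram_unitmx (S : {set 'I_m}) y :
  injective (lam 0) -> (forall i, 0 < lam 0 i) -> (n <= #|S|)%N ->
  (forall i, i \in S -> y 0 i != 0) -> pls_gram y \in unitmx.
Proof.
move=> lam_inj lam_gt0 nS yS.
rewrite -row_free_unit; apply: inj_row_free => u uA.
have : \sum_i lam 0 i * (y 0 i * (rVpoly u).[lam 0 i]) ^+ 2 = 0.
  transitivity ((u *m pls_gram y *m u^T) 0 0); last by rewrite uA mul0mx mxE.
  have wE i : (u *m V^T) 0 i = (rVpoly u).[lam 0 i].
    by rewrite -mul_pls_V_tr -[u in LHS]trmxK -trmx_mul [LHS]mxE.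
  have -> : u *m pls_gram y *m u^T =
      (u *m V^T) *m (diag_mx y *m diag_mx y) *m diag_mx lam *m (u *m V^T)^T.
    by rewrite /pls_gram trmx_mul trmxK !mulmxA.
  move: (u *m V^T) wE => w wE.
  rewrite mulmx_diag !mul_mx_diag mxE; apply: eq_bigr => i _.
  by rewrite !mxE wE; ring.
move/eqP; rewrite psumr_eq0 => [/allP u0|i _]; last first.
  by rewrite mulr_ge0 ?sqr_ge0// ltW.
have /eqP p0 : rVpoly u == 0.
  apply: contraT => p0.
  have := @max_poly_roots _ (rVpoly u) [seq lam 0 i | i <- enum S] p0.
  rewrite map_inj_uniq// enum_uniq size_map -cardE => /(_ _ isT) Sp.
  suff : (#|S| < n)%N by rewrite ltnNge nS.
  apply: leq_trans (size_poly _ _); apply: Sp.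
  apply/allP => x /mapP[i + ->]; rewrite mem_enum => iS.
  have /= := u0 i (mem_index_enum i).
  by rewrite mulf_eq0 gt_eqF//= sqrf_eq0 mulf_eq0 (negPf (yS _ iS)).
by rewrite -[u]rVpolyK p0 linear0.
Qed.

(* [u] is an arbitrary trial coefficient vector: comparing with a fixed [u]
   avoids differentiating the inverse matrix. *)
Lemma pls_pred_residual z u i : pls_gram z \in unitmx ->
  pls_pred n lam z 0 i = z 0 i * (lam 0 i * (rVpoly u).[lam 0 i]) +
    \sum_j pls_gain z i j *
      (z 0 j ^+ 2 * (1 - lam 0 j * (rVpoly u).[lam 0 j])).
Proof.
move=> zu; set Y := diag_mx z; set L := diag_mx lam.
(* The inverse cancels the Gram matrix: the fit reproduces every vector in the range of Y Lambda V,
   so only the residual of the trial vector is left. *)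
have gainE : pls_gain z *m (Y *m Y *m L *m (V *m u^T)) = Y *m L *m (V *m u^T).
  transitivity (Y *m L *m V *m invmx (pls_gram z) *m pls_gram z *m u^T).
    by rewrite /pls_gain /pls_gram !mulmxA.
  by rewrite mulmxKV// !mulmxA.
have -> : pls_pred n lam z = (Y *m L *m (V *m u^T) +
    pls_gain z *m (Y *m z^T - Y *m Y *m L *m (V *m u^T)))^T.
  by rewrite mulmxBr gainE addrC subrK [in RHS]mulmxA.
have vE j : (V *m u^T) j 0 = (rVpoly u).[lam 0 j] by exact: mul_pls_V_tr.
move: (pls_gain z) (V *m u^T) vE {gainE} => G v vE.
rewrite -!mulmxA !mul_diag_mx !mxE vE; congr (_ + _).
by apply: eq_bigr => j _; rewrite !mxE vE; ring.
Qed.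

Lemma cvg_pls_gain_entries (T : Type) (F : set_system T) {FF : Filter F}
    (z : T -> 'rV[R]_m) y :
  pls_gram y \in unitmx ->
  (forall i, z t 0 i @[t --> F] --> y 0 i) ->
  (\forall t \near F, pls_gram (z t) \in unitmx) /\
  (forall i j, pls_gain (z t) i j @[t --> F] --> pls_gain y i j).
Proof.
move=> yu zy.
have cY i j : diag_mx (z t) i j @[t --> F] --> diag_mx y i j.
  rewrite mxE; under eq_fun do rewrite mxE.
  by case: eqP => _; [exact: zy|exact: cvg_cst].
have cA : forall i j, pls_gram (z t) i j @[t --> F] --> pls_gram y i j.
  rewrite /pls_gram.
  do 2![apply: cvg_mulmx_entries; last by move=> i j; exact: cvg_cst].
  apply: cvg_mulmx_entries => [i j|]; first exact: cvg_cst.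
  exact: cvg_mulmx_entries.
have [Au cAi] := cvg_invmx_entries yu cA.
split=> //; rewrite /pls_gain.
apply: cvg_mulmx_entries; last by move=> i j; exact: cvg_cst.
apply: cvg_mulmx_entries => //.
by do 2![apply: cvg_mulmx_entries; last by move=> i j; exact: cvg_cst].
Qed.

Lemma jacobian_pls_pred (S : {set 'I_m}) y :
  injective (lam 0) -> (forall i, 0 < lam 0 i) -> #|S| = n ->
  (forall i, i \in S -> y 0 i != 0) -> (forall i, i \notin S -> y 0 i = 0) ->
  jacobian (pls_pred n lam) y =
    diag_mx (\row_i (1 - \prod_(j in S) (1 - lam 0 i / lam 0 j))).
Proof.
move=> lam_inj lam_gt0 cardS yS ynS.
have [u uE] := @horner_prod_interpolation R _ S (fun j => (lam 0 j)^-1) n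
  (eq_leq cardS).
pose s i := \prod_(j in S) (1 - lam 0 i / lam 0 j).
have {}uE i : lam 0 i * (rVpoly u).[lam 0 i] = 1 - s i.
  by rewrite uE; congr (1 - _); apply: eq_bigr => j _; rewrite mulrC.
have s0 i : i \in S -> s i = 0.
  by move=> iS; rewrite /s (bigD1 i)//= divff ?gt_eqF// subrr mul0r.
have yu : pls_gram y \in unitmx.
  by apply: (@pls_gram_unitmx S) => //; rewrite cardS.
have zy i : (h + y) 0 i @[h --> (0 : 'rV[R]_m)] --> y 0 i.
  under eq_fun do rewrite mxE.
  have h0 : (h : 'rV[R]_m) 0 i @[h --> (0 : 'rV[R]_m)] --> (0 : R).
    by have := @coord_continuous R 1 m 0 i 0; rewrite /continuous_at mxE.
  have : (h : 'rV[R]_m) 0 i + y 0 i @[h --> (0 : 'rV[R]_m)] --> 0 + y 0 i.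
    by apply: (cvgD h0); apply: cvg_cst; exact: nbhs_filter.
  by rewrite add0r.
have [Au cG] := cvg_pls_gain_entries yu zy.
(* Any number strictly above the limit bounds the gain entry near y. *)
pose g i j := `|pls_gain y i j| + 1.
have Gg : \forall h \near (0 : 'rV[R]_m),
    forall i j, `|pls_gain (h + y) i j| <= g i j.
  have F0 : Filter (nbhs (0 : 'rV[R]_m)) by exact: nbhs_filter.
  apply: (@filter_forall _ _ _ _ F0) => i.
  apply: (@filter_forall _ _ _ _ F0) => j.
  by apply: (cvgr_norm_le _ (cG i j)); rewrite ltrDl.
(* Summing over all rows gives one constant that serves every entry. *)
apply: (@jacobian_quadratic_remainder _ _ _ _ _ _
  (\sum_i \sum_j g i j * `|s j|)).
apply: filterS2 Au Gg => h Au Gg; apply: mx_norm_le => [|k i].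
  apply: mulr_ge0; rewrite ?sqr_ge0// sumr_ge0// => i _.
  by rewrite sumr_ge0// => j _; rewrite mulr_ge0// addr_ge0.
rewrite (ord1 k) mul_mx_diag.
have -> : (pls_pred n lam (h + y) - pls_pred n lam y -
    (\matrix_(i0, j) (h i0 j * (\row_i1 (1 - s i1)) 0 j))) 0 i =
    \sum_j pls_gain (h + y) i j * (h 0 j ^+ 2 * s j).
  transitivity (pls_pred n lam (h + y) 0 i - pls_pred n lam y 0 i -
      h 0 i * (1 - s i)).
    by move: (pls_pred n lam (h + y)) (pls_pred n lam y) => a b; rewrite !mxE.
  rewrite (pls_pred_residual u i Au) (pls_pred_residual u i yu) uE.
  (* At y itself each residual term is zero: s_j = 0 on S and y_j = 0 off S. *)
  rewrite [X in _ - (_ + X)]big1 => [|j _]; last first.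
    rewrite uE; have [/s0 ->|/ynS ->] := boolP (j \in S).
      by rewrite subr0 subrr !mulr0.
    by rewrite expr0n mul0r mulr0.
  under eq_bigr => j _.
    rewrite uE subKr.
    (* The same dichotomy replaces (h + y)_j by h_j, which makes the remainder quadratic in h. *)
    rewrite (_ : (h + y) 0 j ^+ 2 * s j = h 0 j ^+ 2 * s j); last first.
      have [/s0 ->|/ynS yj] := boolP (j \in S); first by rewrite !mulr0.
      by rewrite mxE yj addr0.
    over.
  rewrite [(h + y) 0 i]mxE; move: (\sum_j _) => r.
  by ring.
rewrite (le_trans (ler_norm_sum _ _ _))//.
apply: (@le_trans _ _ ((\sum_j g i j * `|s j|) * `|h| ^+ 2)); last first.
  rewrite ler_wpM2r ?sqr_ge0// [leRHS](bigD1 i)//= lerDl sumr_ge0// => k' _.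
  by rewrite sumr_ge0// => j _; rewrite mulr_ge0// addr_ge0.
rewrite mulr_suml; apply: ler_sum => j _.
rewrite normrM -[leRHS]mulrA; apply: ler_pM => //.
rewrite normrM mulrC ler_wpM2l// normrX.
by rewrite lerXn2r ?nnegrE// le_mx_entry_norm.
Qed.

End PLS.

(** * Signs of the diagonal entries and the trace bound *)

Lemma card_last_indices m n : (n <= m)%N -> #|last_indices m n| = n.
Proof.
move=> nm; rewrite cardsE -sum1_card -(big_geq_mkord _ _ xpredT (fun=> 1%N)).
by rewrite sum_nat_const_nat muln1 subKn.
Qed.

(** By parity all factors can be negated to F j - 1 > 1. One factor is split off to keep the
    inequality strict, since a possibly empty remaining product is only at least 1. *)
Lemma prodr_even_sub1_gt1 (R : realDomainType) (I : finType) (S : {set I})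
    (F : I -> R) :
  ~~ odd #|S| -> (0 < #|S|)%N -> (forall j, j \in S -> 2 < F j) ->
  1 < \prod_(j in S) (1 - F j).
Proof.
move=> S_even /card_gt0P[k kS] F2.
under eq_bigr do rewrite -opprB.
rewrite prodrN -signr_odd (negPf S_even) mul1r (bigD1 k)//=.
have F1 j : j \in S -> 1 < F j - 1.
  by move=> /F2; rewrite ltrBrDr.
apply: lt_le_trans (F1 _ kS) _.
rewrite ler_peMr ?(ltW (lt_trans ltr01 (F1 _ kS)))//.
elim/big_rec: _ => // j x /andP[/F1/ltW jS _] x1.
exact: mulr_ege1.
Qed.

Theorem mainTheorem5 (R : realType) (m n : nat) (lam y : 'rV[R]_m)
    (p q : 'I_m) (c : R)
    (n_ge1 : (1 <= n)%N) (n_lt_m : (n < m)%N)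
    (lam_decr : forall i j : 'I_m, (i < j)%N -> lam 0 j < lam 0 i)
    (lam_pos : forall i : 'I_m, 0 < lam 0 i)
    (n_even : ~~ odd n)
    (p_val : p = (m - n).-1 :> nat) (q_val : q = (m - n)%N :> nat)
    (c_def : c = lam 0 p / lam 0 q) (c_gt2 : 2 < c)
    (y_in : forall i : 'I_m, i \in last_indices m n -> y 0 i != 0)
    (y_out : forall i : 'I_m, i \notin last_indices m n -> y 0 i = 0) :
  sample_GDoF n lam y < n%:R.
Proof.
have lam_le (i j : 'I_m) : (i <= j)%N -> lam 0 j <= lam 0 i.
  by rewrite leq_eqVlt => /predU1P[/val_inj->//|/lam_decr/ltW].
have lam_inj : injective (lam 0).
  move=> i j lamE; apply: val_inj; case: (ltngtP i j) => // /lam_decr;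
    by rewrite lamE ltxx.
set S := last_indices m n in y_in y_out *.
have cardS : #|S| = n by apply: card_last_indices; exact: ltnW.
have qS : q \in S by rewrite inE q_val.
(* As n < m, the predecessor of m - n is a genuine decrement, so p is the last position outside
   S. *)
have pS : p \notin S by rewrite inE p_val -ltnNge prednK// subn_gt0.
(* Here i <= p and q <= j, so monotonicity reduces every ratio to c. *)
have ratio_gt2 i j : i \notin S -> j \in S -> 2 < lam 0 i / lam 0 j.
  rewrite !inE -ltnNge => iS jS; rewrite ltr_pdivlMr//.
  apply: (@le_lt_trans _ _ (2 * lam 0 q)).
    by rewrite ler_pM2l// lam_le// q_val.
  apply: (@lt_le_trans _ _ (lam 0 p)).
    by rewrite -ltr_pdivlMr// -c_def.
  by apply: lam_le; rewrite p_val -ltnS prednK// subn_gt0.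
pose t i := 1 - \prod_(j in S) (1 - lam 0 i / lam 0 j).
have t_in i : i \in S -> t i = 1.
  by move=> iS; rewrite /t (bigD1 i)//= divff ?gt_eqF// subrr mul0r subr0.
have t_out i : i \notin S -> t i < 0.
  move=> iS; rewrite subr_lt0; apply: prodr_even_sub1_gt1.
  - by rewrite cardS.
  - by rewrite cardS.
  - by move=> j; exact: ratio_gt2.
rewrite /sample_GDoF /pls_J mxtrace_tr.
rewrite (jacobian_pls_pred lam_inj lam_pos cardS y_in y_out) mxtrace_diag.
under eq_bigr do rewrite mxE -/(t _).
rewrite (bigID (mem S))/= (eq_bigr (fun=> 1)) => [|i /t_in//].
(* S contributes exactly n; the term at p makes the rest of the sum strictly negative. *)
rewrite sumr_const cardS gtrDl (bigD1 p)//=.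
rewrite ltr_nwDl ?t_out//.
by apply: sumr_le0 => i /andP[/t_out/ltW].
Qed.
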